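(* Let $\mathbb{F}$ be a finite field with $q$ elements, $r_1,\dots,r_s$ positive integers, and $n=r_1\cdots r_s$ with $\gcd(n,q)=1$. Let $\boldsymbol{\alpha}\in U$ be fixed and let $C$ be an abelian code in $\mathbb{F}(r_1,\dots,r_s)$. Then $$\dim_{\mathbb{F}}(C)=|\mathcal{I}\setminus\mathcal{D}_{\boldsymbol{\alpha}}(C)|=n-|\mathcal{D}_{\boldsymbol{\alpha}}(C)|.$$
   Context: $\mathbb{F}(r_1,\dots,r_s)=\mathbb{F}[X_1,\dots,X_s]/\langle X_1^{r_1}-1,\dots,X_s^{r_s}-1\rangle$. An abelian code is an ideal of this algebra. Put $\mathcal{I}=\mathbb{Z}_{r_1}\times\cdots\times\mathbb{Z}_{r_s}$, elements being written by canonical representatives. $\mathbb{L}$ is an extension field of $\mathbb{F}$ containing, for every $i$, the primitive $r_i$-th roots of unity; $U=\prod_{i=1}^s U_{r_i}$, where $U_{r_i}\subseteq \mathbb{L}$ is the set of primitive $r_i$-th roots of unity. For $\boldsymbol{\alpha}=(\alpha_1,\dots,\alpha_s)\in U$ and $m=(m_1,\dots,m_s)\in\mathcal{I}$, $\boldsymbol{\alpha}^m=(\alpha_1^{m_1},\dots,\alpha_s^{m_s})$. For $f\in\mathbb{F}(r_1,\dots,r_s)$, $f(\boldsymbol{\alpha}^m)$ is the value at $\boldsymbol{\alpha}^m$ of the canonical representative of $f$ (or of any representative). The defining set of $C$ with respect to $\boldsymbol{\alpha}$ is $\mathcal{D}_{\boldsymbol{\alpha}}(C)=\{m\in\mathcal{I}\mid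 f(\boldsymbol{\alpha}^m)=0\ \text{for all } f\in C\}$. *)

(* Defs.v *)
From HB Require Import structures.
From mathcomp Require Import all_boot all_algebra.
From mathcomp Require Import ring_quotient.
From mathcomp.classical Require Import boolp.
From mathcomp.multinomials Require Import ssrcomplements mpoly.

Set Implicit Arguments.
Unset Strict Implicit.
Unset Printing Implicit Defensive.

Import GRing.Theory.
Local Open Scope ring_scope.
Local Open Scope quotient_scope.

(* The set I = Z_{r_1} x ... x Z_{r_s}, by canonical representatives. *)
Notation indices r := {dffun forall i, 'I_(r i)}.

Lemma card_indices (s : nat) (r : 'I_s -> nat) :
  #|{: indices r}| = (\prod_(i < s) r i)%N.
Proof.
by rewrite card_dep_ffun foldrE big_image /=; apply: eq_bigr => i _; rewrite card_ord.
Qed.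

Section RelationIdeal.
Variables (F : fieldType) (s : nat) (r : 'I_s -> nat).

Definition relation_ideal : {pred {mpoly F[s]}} := fun p =>
  `[< exists g : 'I_s -> {mpoly F[s]}, p = \sum_i g i * ('X_i ^+ r i - 1) >].

Lemma relation_idealP (p : {mpoly F[s]}) :
  reflect (exists g : 'I_s -> {mpoly F[s]}, p = \sum_i g i * ('X_i ^+ r i - 1))
          (p \in relation_ideal).
Proof. exact: asboolP. Qed.

Lemma relation_ideal_closed : idealr_closed relation_ideal.
Proof.
split.
- apply/relation_idealP; exists (fun=> 0).
  by rewrite big1 // => i _; rewrite mul0r.
- apply/negP => /relation_idealP [g] /(congr1 (meval (fun=> 1))).
  rewrite meval1 raddf_sum big1 => [/eqP|i _] /=; first by rewrite oner_eq0.
  by rewrite mevalM mevalB rmorphXn /= mevalXU expr1n meval1 subrr mulr0.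
- move=> a u v /relation_idealP [g ->] /relation_idealP [h ->].
  apply/relation_idealP; exists (fun i => a * g i + h i).
  rewrite mulr_sumr -big_split; apply: eq_bigr => i _ /=.
  by rewrite mulrDl mulrA.
Qed.

HB.instance Definition _ :=
  isIdealr.Build {mpoly F[s]} relation_ideal relation_ideal_closed.

Lemma relation_ideal_meval (L : fieldType) (iota : {rmorphism F -> L})
    (x : 'I_s -> L) (p : {mpoly F[s]}) :
  (forall i, x i ^+ r i = 1) -> p \in relation_ideal ->
  (map_mpoly iota p).@[x] = 0.
Proof.
move=> x1 /relation_idealP [g ->].
rewrite (rmorph_sum (map_mpoly iota)) (rmorph_sum (meval x)).
rewrite big1 // => i _ /=.
rewrite rmorphM /= rmorphB /= rmorphXn rmorph1 /= map_mpolyX.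
rewrite mevalM mevalB rmorphXn /= mevalXU meval1 x1.
by rewrite subrr mulr0.
Qed.

End RelationIdeal.
Arguments relation_ideal F {s} r _.

(* The proof that the r_i are positive is a parameter because it is what makes
   the algebra finite-dimensional. *)
Definition abelian_algebra (F : fieldType) (s : nat) (r : 'I_s -> nat)
  (r_gt0 : forall i, (0 < r i)%N) : Type := {ideal_quot (relation_ideal F r)}.

Section AbelianAlgebra.
Variables (F : fieldType) (s : nat) (r : 'I_s -> nat).
Hypothesis r_gt0 : forall i, (0 < r i)%N.

Local Notation A := (abelian_algebra F r_gt0).
Local Notation Q := {ideal_quot (relation_ideal F r)}.
Local Notation I := (indices r).

HB.instance Definition _ := GRing.ComNzRing.copy A Q.

Definition to_abelian_algebra (p : {mpoly F[s]}) : A := \pi_Q p.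
Local Notation cl := to_abelian_algebra.

Lemma to_abelian_algebra_is_zmod_morphism : zmod_morphism cl.
Proof. exact: (raddfB (\pi_Q : {additive _ -> Q})). Qed.

Lemma to_abelian_algebra_is_monoid_morphism : monoid_morphism cl.
Proof. exact: (pi_is_monoid_morphism Q). Qed.

HB.instance Definition _ := GRing.isZmodMorphism.Build {mpoly F[s]} A cl
  to_abelian_algebra_is_zmod_morphism.
HB.instance Definition _ := GRing.isMonoidMorphism.Build {mpoly F[s]} A cl
  to_abelian_algebra_is_monoid_morphism.

Definition representative (f : A) : {mpoly F[s]} := repr (f : Q).

Lemma representativeK (f : A) : cl (representative f) = f.
Proof. exact: reprK. Qed.

Lemma to_abelian_algebra_eq (p q : {mpoly F[s]}) :
  (cl p == cl q) = (p - q \in relation_ideal F r).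
Proof. by rewrite (Quotient.idealrBE (relation_ideal F r)). Qed.

Definition abelian_scale (c : F) (f : A) : A := cl c%:MP * f.

Lemma abelian_scaleA (a b : F) (f : A) :
  abelian_scale a (abelian_scale b f) = abelian_scale (a * b) f.
Proof. by rewrite /abelian_scale mulrA -rmorphM /= mpolyCM. Qed.

Lemma abelian_scale1 : left_id 1 abelian_scale.
Proof. by move=> f; rewrite /abelian_scale rmorph1 mul1r. Qed.

Lemma abelian_scaleDr : right_distributive abelian_scale +%R.
Proof. by move=> a f g; rewrite /abelian_scale mulrDr. Qed.

Lemma abelian_scaleDl (f : A) : {morph abelian_scale^~ f : a b / a + b}.
Proof. by move=> a b; rewrite /abelian_scale mpolyCD rmorphD mulrDl. Qed.

HB.instance Definition _ := GRing.Zmodule_isLmodule.Build F A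
  abelian_scaleA abelian_scale1 abelian_scaleDr abelian_scaleDl.

Lemma abelian_scaleAl (a : F) (f g : A) : a *: (f * g) = (a *: f) * g.
Proof. exact: mulrA. Qed.

HB.instance Definition _ := GRing.Lmodule_isLalgebra.Build F A abelian_scaleAl.

Lemma abelian_scaleAr (a : F) (f g : A) : a *: (f * g) = f * (a *: g).
Proof. exact: mulrCA. Qed.

HB.instance Definition _ := GRing.Lalgebra_isAlgebra.Build F A abelian_scaleAr.

Lemma to_abelian_algebraZ (c : F) (p : {mpoly F[s]}) : cl (c *: p) = c *: cl p.
Proof. by rewrite -mul_mpolyC rmorphM. Qed.

Definition reduce_index (k : 'X_{1..s}) : I :=
  finfun (fun i => Ordinal (ltn_pmod (k i) (r_gt0 i))).

Definition index_monomial (m : I) : 'X_{1..s} := [multinom val (m i) | i < s].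

Lemma index_monomialK : cancel index_monomial reduce_index.
Proof.
move=> m; apply/ffunP => i; apply: val_inj.
by rewrite ffunE /= mnmE modn_small //; exact: ltn_ord.
Qed.

(* The coefficients of the canonical representative of the class of p. *)
Definition reduced_coefs (p : {mpoly F[s]}) : 'rV[F]_#|{: I}| :=
  \sum_(k <- msupp p) p@_k *: delta_mx 0 (enum_rank (reduce_index k)).

Lemma reduced_coefsE w (p : {mpoly F[s]}) : (msize p <= w)%N -> reduced_coefs p =
  \sum_(k : 'X_{1..s < w}) p@_k *: delta_mx 0 (enum_rank (reduce_index k)).
Proof.
move=> le_pw; rewrite /reduced_coefs.
rewrite (big_mksub ('X_{1..s < w} : subFinType _)) ?msupp_uniq //=; last first.
  by move=> k /msize_mdeg_lt /leq_trans; apply.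
by rewrite big_rmcond //= => j /memN_msupp_eq0 ->; rewrite scale0r.
Qed.

Lemma reduced_coefs_linear : linear reduced_coefs.
Proof.
move=> a p q; set w := maxn (msize (a *: p + q)) (maxn (msize p) (msize q)).
rewrite !(@reduced_coefsE w) ?leq_max ?leqnn ?orbT //.
rewrite scaler_sumr -big_split; apply: eq_bigr => k _ /=.
by rewrite mcoeffD mcoeffZ scalerDl scalerA.
Qed.

HB.instance Definition _ := GRing.isLinear.Build F {mpoly F[s]} _ _
  reduced_coefs reduced_coefs_linear.

Lemma reduced_coefsZ c p : reduced_coefs (c *: p) = c *: reduced_coefs p.
Proof. exact: linearZ_LR. Qed.

Lemma reduced_coefsX k :
  reduced_coefs 'X_[k] = delta_mx 0 (enum_rank (reduce_index k)).
Proof. by rewrite /reduced_coefs msuppX big_seq1 mcoeffX eqxx scale1r. Qed.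

Lemma reduced_coefs_ideal p : p \in relation_ideal F r -> reduced_coefs p = 0.
Proof.
move=> /relation_idealP [g ->]; rewrite (raddf_sum reduced_coefs) big1 // => i _.
rewrite [g i]mpolyE mulr_suml (raddf_sum reduced_coefs) big1 // => k _.
rewrite /= -scalerAl reduced_coefsZ mulrBr mulr1 mpolyXn -mpolyXD.
rewrite (raddfB reduced_coefs) /= !reduced_coefsX.
suff -> : reduce_index (k + U_(i) *+ r i) = reduce_index k.
  by rewrite subrr scaler0.
apply/ffunP => j; apply: val_inj; rewrite !ffunE /= mnmDE mulmnE mnm1E.
by have [->|_] := eqVneq i j; rewrite ?mul1n ?modnDr ?mul0n ?addn0.
Qed.

Lemma to_abelian_algebraX k :
  cl 'X_[k] = cl 'X_[index_monomial (reduce_index k)].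
Proof.
rewrite !mpolyXE_id !rmorph_prod; apply: eq_bigr => i _ /=.
rewrite mnmE ffunE /= [in LHS](divn_eq (k i) (r i)) exprD mulnC exprM rmorphM /=.
have -> : cl (('X_i ^+ r i) ^+ (k i %/ r i)) = 1.
  rewrite rmorphXn /=; suff -> : cl ('X_i ^+ r i) = 1 by rewrite expr1n.
  apply/eqP; rewrite -(rmorph1 cl) to_abelian_algebra_eq.
  apply/relation_idealP; exists (fun j => (i == j)%:R).
  rewrite (bigD1 i) //= eqxx mul1r big1 ?addr0 // => j.
  by rewrite eq_sym => /negbTE ->; rewrite mul0r.
by rewrite mul1r.
Qed.

Definition of_coefs (v : 'rV[F]_#|{: I}|) : {mpoly F[s]} :=
  \sum_j v 0 j *: 'X_[index_monomial (enum_val j)].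

Lemma of_coefsK : cancel of_coefs reduced_coefs.
Proof.
move=> v; rewrite [RHS]row_sum_delta (raddf_sum reduced_coefs); apply: eq_bigr => j _ /=.
by rewrite reduced_coefsZ reduced_coefsX index_monomialK enum_valK.
Qed.

Lemma of_coefs_linear : linear of_coefs.
Proof.
move=> a u v; rewrite /of_coefs scaler_sumr -big_split; apply: eq_bigr => j _.
by rewrite /= !mxE scalerDl scalerA.
Qed.

HB.instance Definition _ := GRing.isLinear.Build F _ {mpoly F[s]} _
  of_coefs of_coefs_linear.

Lemma of_coefs_delta m : of_coefs (delta_mx 0 (enum_rank m)) = 'X_[index_monomial m].
Proof.
rewrite /of_coefs (bigD1 (enum_rank m)) //= mxE !eqxx scale1r enum_rankK.
by rewrite big1 ?addr0 // => j /negbTE neq_j; rewrite mxE neq_j andbF scale0r.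
Qed.

Lemma reduced_coefsK (p : {mpoly F[s]}) : cl (of_coefs (reduced_coefs p)) = cl p.
Proof.
rewrite {1}/reduced_coefs [in RHS](mpolyE p) (raddf_sum of_coefs) !(raddf_sum cl).
apply: eq_bigr => k _ /=.
have -> c v : of_coefs (c *: v) = c *: of_coefs v by exact: linearZ_LR.
by rewrite of_coefs_delta !to_abelian_algebraZ -to_abelian_algebraX.
Qed.

Lemma abelian_algebra_vect : Vector.axiom #|{: I}| A.
Proof.
exists (reduced_coefs \o representative).
  move=> a f g /=; rewrite -linearP; apply/eqP; rewrite -subr_eq0 -raddfB.
  apply/eqP; apply: reduced_coefs_ideal; rewrite -to_abelian_algebra_eq.
  by rewrite rmorphD /= to_abelian_algebraZ !representativeK.
exists (cl \o of_coefs) => [f|v] /=.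
  by rewrite reduced_coefsK representativeK.
rewrite -[RHS]of_coefsK; apply/eqP; rewrite -subr_eq0 -raddfB.
apply/eqP; apply: reduced_coefs_ideal; rewrite -to_abelian_algebra_eq.
by rewrite representativeK.
Qed.

HB.instance Definition _ :=
  Lmodule_hasFinDim.Build F A abelian_algebra_vect.

Definition abelian_code (C : {vspace A}) : Prop :=
  forall a c : A, c \in C -> a * c \in C.

Section DefiningSet.
Variables (L : fieldType) (iota : {rmorphism F -> L}).

(* The representative is the one chosen by the quotient, not the one of degree
   < r_i in X_i; eval_at_class shows that any representative gives the same
   value at the points considered. *)
Definition eval_at (f : A) (x : 'I_s -> L) : L :=
  (map_mpoly iota (representative f)).@[x].

Lemma eval_at_class (p : {mpoly F[s]}) (x : 'I_s -> L) :
  (forall i, x i ^+ r i = 1) -> eval_at (cl p) x = (map_mpoly iota p).@[x].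
Proof.
move=> x1; apply/eqP; rewrite -subr_eq0 -mevalB -rmorphB.
apply/eqP; apply: (@relation_ideal_meval _ _ r) => //.
by rewrite -to_abelian_algebra_eq representativeK.
Qed.

Definition root_power (alpha : 'I_s -> L) (m : I) : 'I_s -> L :=
  fun i => alpha i ^+ m i.

Definition defining_set (alpha : 'I_s -> L) (C : {vspace A}) : {set I} :=
  [set m | `[< forall f, f \in C -> eval_at f (root_power alpha m) = 0 >]].

End DefiningSet.
End AbelianAlgebra.

(* Main.v *)
(** Evaluating at the n points alpha^m maps the algebra A into L^n. Since A has
    dimension n and the monomials already span L^n over L (a polynomial vanishing
    at all the points but one is a combination of monomials), evaluation becomes
    an isomorphism after extending scalars to L, so dim C is the rank over L of
    the values of C. As C is an ideal, the L-span of these values is stable under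
    pointwise multiplication by the values of the monomials, hence by all of L^n:
    it is the coordinate subspace supported by the m at which some element of C
    does not vanish. *)
From HB Require Import structures.
Require Import Defs.
From mathcomp Require Import all_boot all_algebra.
From mathcomp.classical Require Import boolp.
From mathcomp.multinomials Require Import mpoly.

Import GRing.Theory VectorInternalTheory.

(** The row space of [E] is that of the matrix [P] of unit vectors indexed by [S], whose rows are
    independent because its transpose is a right inverse. *)
Lemma rank_coordinate_subspace (K : fieldType) (m n : nat) (E : 'M[K]_(m, n))
    (S : {set 'I_n}) :
  (forall i j, j \notin S -> E i j = 0%R) ->
  (forall j, j \in S -> (delta_mx (0%R : 'I_1) j <= E)%MS) -> \rank E = #|S|.
Proof.
move=> E0 SE; pose P : 'M[K]_(#|S|, n) := (\matrix_i delta_mx 0 (enum_val i))%R.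
have PE : (P :=: E)%MS.
  apply/eqmxP/andP; split; apply/row_subP => i.
    by rewrite rowK; apply/SE/enum_valP.
  rewrite (row_sum_delta (row i E)); apply: summx_sub => j _; rewrite mxE.
  have [jS | /E0->] := boolP (j \in S); last by rewrite scale0r sub0mx.
  apply: scalemx_sub; suff -> : delta_mx 0%R j = row (enum_rank_in jS j) P.
    exact: row_sub.
  by rewrite rowK enum_rankK_in.
rewrite -PE; apply/eqP/row_freeP; exists (P^T)%R; apply/row_matrixP => i.
rewrite row_mul rowK; apply/rowP => k; rewrite -rowE !mxE eqxx /=.
by rewrite (inj_eq enum_val_inj).
Qed.

Lemma memv_vs2mx (K : fieldType) (vT : vectType K) (v : vT) (U : {vspace vT}) :
  (v \in U) = (v2r v <= vs2mx U)%MS.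
Proof. by rewrite -genmxE. Qed.

Section EvaluationCode.
Local Open Scope ring_scope.
Variables (F : fieldType) (s : nat) (r : 'I_s -> nat).
Hypothesis r_gt0 : forall i, (0 < r i)%N.
Variables (L : fieldType) (iota : {rmorphism F -> L}) (alpha : 'I_s -> L).
Hypothesis alphaU : forall i, (r i).-primitive_root (alpha i).

Local Notation A := (abelian_algebra F r_gt0).
Local Notation I := (indices r).
Local Notation cl := (to_abelian_algebra (F := F) (s := s) (r := r) r_gt0).

Definition point (j : 'I_#|{: I}|) : 'I_s -> L := root_power alpha (enum_val j).

Lemma point_expr j i : point j i ^+ r i = 1.
Proof.
by rewrite /point /root_power -exprM mulnC exprM (prim_expr_order (alphaU i)) expr1n.
Qed.

Definition ev (f : A) : 'rV[L]_#|{: I}| := \row_j eval_at iota f (point j).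

Lemma ev_class p j : ev (cl p) 0 j = (map_mpoly iota p).@[point j].
Proof. by rewrite mxE eval_at_class //; apply: point_expr. Qed.

Lemma ev_additive : zmod_morphism ev.
Proof.
move=> f g; rewrite -(representativeK f) -(representativeK g) -rmorphB /=.
by apply/rowP => j; rewrite !mxE -[RHS]/(_ - _) !eval_at_class ?rmorphB ?mevalB //;
  apply: point_expr.
Qed.

HB.instance Definition _ := GRing.isZmodMorphism.Build A _ ev ev_additive.

Lemma evM f g j : ev (f * g) 0 j = ev f 0 j * ev g 0 j.
Proof.
rewrite -(representativeK f) -(representativeK g) -rmorphM /=.
by rewrite !ev_class rmorphM mevalM.
Qed.

Lemma evZ c f : ev (c *: f) = iota c *: ev f.
Proof.
rewrite -(representativeK f) -to_abelian_algebraZ; apply/rowP => j.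
by rewrite [RHS]mxE !ev_class map_mpolyZ mevalZ.
Qed.

Lemma ev_monomial k j : ev (cl 'X_[k]) 0 j = ('X_[k] : {mpoly L[s]}).@[point j].
Proof. by rewrite ev_class map_mpolyX. Qed.

(** In each variable, the linear factors remove all powers of [alpha i] except the [m i]-th;
    primitivity makes the powers with exponent below [r i] distinct. *)
Lemma separating_poly (j : 'I_#|{: I}|) :
  exists p : {mpoly L[s]}, forall j', (p.@[point j'] != 0) = (j' == j).
Proof.
set m := enum_val j.
exists (\prod_i \prod_(k < r i | k != m i) ('X_i - (alpha i ^+ k)%:MP)) => j'.
rewrite rmorph_prod; apply/idP/eqP => [/prodf_neq0 nz | ->].
  apply: enum_val_inj; apply/ffunP => i; apply/eqP/negPn/negP => ne.
  (* At a coordinate [i] where the two indices differ, the factor with [k] equal to [enum_val j' i]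
     vanishes at [point j']. *)
  move: (nz i isT); rewrite /= rmorph_prod (bigD1 (enum_val j' i)) //=.
  by rewrite mevalB mevalXU mevalC subrr mul0r eqxx.
apply/prodf_neq0 => i _; rewrite /= rmorph_prod; apply/prodf_neq0 => k ne /=.
rewrite mevalB mevalXU mevalC subr_eq0 (eq_prim_root_expr (alphaU i)) eq_sym.
by rewrite !modn_small.
Qed.

(* Applied with v = 1 to show that the monomials span L^n, and with v = ev f to
   show that the values of an ideal span a coordinate subspace. *)
Lemma delta_sub_of_monomials n (W : 'M[L]_(n, #|{: I}|)) (v : 'rV[L]_#|{: I}|) :
  (forall k, (\row_j (ev (cl 'X_[k]) 0 j * v 0 j)%R <= W)%MS) ->
  forall j, v 0 j != 0 -> (delta_mx (0 : 'I_1) j <= W)%MS.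
Proof.
move=> subW j vj; have [p p_sep] := separating_poly j.
have pj : p.@[point j] * v 0 j != 0 by rewrite mulf_neq0 // p_sep.
(* The pointwise product of [v] with the values of [p] has its only nonzero entry at [j]; rescaling
   gives the unit vector. *)
suff /(scalemx_sub (p.@[point j] * v 0 j)^-1) :
    (\row_j' (p.@[point j'] * v 0 j')%R <= W)%MS.
  congr (_ <= _)%MS; apply/rowP => j'; rewrite !mxE eqxx /=.
  have [-> | ne] := eqVneq j' j; first by rewrite mulVf.
  by move: (p_sep j'); rewrite (negPf ne) => /negbFE/eqP->; rewrite mul0r mulr0.
have -> : \row_j' (p.@[point j'] * v 0 j')
    = \sum_(k <- msupp p) p@_k *: \row_j' (ev (cl 'X_[k]) 0 j' * v 0 j').
  apply/rowP => j'; rewrite summxE mxE [in LHS](mpolyE p) rmorph_sum mulr_suml.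
  by apply: eq_bigr => k _; rewrite [RHS]mxE [in RHS]mxE ev_monomial /= mevalZ mulrA.
by apply: summx_sub => k _; apply: scalemx_sub.
Qed.

(** Evaluation is only semilinear along [iota]; this is the matrix of its [L]-linear extension, in
    an [F]-basis of [A]. *)
Definition ev_mx : 'M[L]_(dim A, #|{: I}|) :=
  \matrix_k ev (r2v (delta_mx 0 k)).

Lemma ev_v2r (f : A) : ev f = map_mx iota (v2r f) *m ev_mx.
Proof.
rewrite -[in LHS](v2rK f) [in LHS](row_sum_delta (v2r f)) !raddf_sum mulmx_sum_row.
by apply: eq_bigr => k _; rewrite /= linearZ /= evZ rowK mxE.
Qed.

(** Independence of the rows is deduced from spanning: every unit vector is obtained from values of
    monomials. *)
Lemma ev_mx_free : row_free ev_mx.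
Proof.
have full : row_full ev_mx.
  rewrite -sub1mx; apply/row_subP => j; rewrite rowE mulmx1.
  apply: (@delta_sub_of_monomials _ _ (const_mx 1)) => [k|]; last first.
    by rewrite mxE oner_neq0.
  suff -> : \row_j' (ev (cl 'X_[k]) 0 j' * (const_mx 1 : 'rV_#|{: I}|) 0 j')
            = ev (cl 'X_[k]) by rewrite ev_v2r submxMl.
  by apply/rowP => j'; rewrite mxE [const_mx _ _ _]mxE mulr1.
(* [dim A] is convertible to [#|{: I}|], so [ev_mx] is square. *)
by rewrite /row_free (eqP full).
Qed.

Lemma dim_abelian_code (C : {vspace A}) : abelian_code C ->
  \dim C = #|~: defining_set iota alpha C|.
Proof.
move=> codeC; pose E := map_mx iota (vs2mx C) *m ev_mx.
have evE f : f \in C -> (ev f <= E)%MS.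
  by rewrite memv_vs2mx ev_v2r => fC; apply: submxMr; rewrite map_submx.
(* Neither extending scalars along [iota] nor multiplying on the right by the row-free [ev_mx]
   changes the rank. *)
have -> : \dim C = \rank E by rewrite mxrankMfree ?ev_mx_free // mxrank_map.
have zeroP (j : 'I_#|{: I}|) : reflect (forall f, f \in C -> ev f 0 j = 0)
    (enum_val j \in defining_set iota alpha C).
  rewrite inE; apply: (iffP (asboolP _)) => Cj f fC; first by rewrite mxE Cj.
  by rewrite -(Cj f fC) mxE.
rewrite (@rank_coordinate_subspace _ _ _ _
  [set j | enum_val j \notin defining_set iota alpha C]).
- rewrite -(card_imset _ (@enum_val_inj _ (mem {: I}))); apply: eq_card => m.
  rewrite in_setC; apply/imsetP/idP => [[j] | Dm]; first by rewrite in_set => ? ->.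
  by exists (enum_rank m); rewrite 1?in_set enum_rankK.
- move=> i j; rewrite in_set negbK => /zeroP Cj.
  have -> : E i j = ev (r2v (row i (vs2mx C))) 0 j.
    by rewrite ev_v2r r2vK map_row -row_mul [RHS]mxE.
  by apply: Cj; rewrite memv_vs2mx r2vK row_sub.
- move=> j; rewrite in_set => nD.
  have [f fC fj] : exists2 f, f \in C & ev f 0 j != 0.
    apply: contrapT => no_f; case/zeroP: nD => f fC; apply/eqP/negPn/negP => fj.
    by apply: no_f; exists f.
  apply: (@delta_sub_of_monomials _ _ (ev f)) => // k.
  (* The ideal property enters here: [C] contains the product of [f] with any monomial class. *)
  suff -> : \row_j' (ev (cl 'X_[k]) 0 j' * ev f 0 j') = ev (cl 'X_[k] * f).
    by apply: evE; apply: codeC.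
  by apply/rowP => j'; rewrite mxE evM.
Qed.

End EvaluationCode.

Theorem theorem17 (F : finFieldType) (s : nat) (r : 'I_s -> nat)
    (r_gt0 : forall i, 0 < r i)
    (coprime_nq : coprime (\prod_(i < s) r i) #|F|)
    (L : fieldType) (iota : {rmorphism F -> L})
    (alpha : 'I_s -> L) (alphaU : forall i, ((r i).-primitive_root (alpha i))%R)
    (C : {vspace abelian_algebra F r_gt0}) (codeC : abelian_code C) :
  (\dim C = #|~: defining_set iota alpha C| /\
   #|~: defining_set iota alpha C|
     = \prod_(i < s) r i - #|defining_set iota alpha C|)%N.
Proof.
split; first exact: dim_abelian_code.
by rewrite cardsCs setCK card_indices.
Qed.
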